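(* Let $\boldsymbol a=\Gamma\curvearrowright^a(X,\mu)$ be a non-trivial measure preserving action of the countable group $\Gamma$. Suppose that $\boldsymbol a$ is NA-ergodic. Then the stabilizer $\Gamma_x$ of $\mu$-almost every $x\in X$ is amenable. In addition, at least one of the following is true: (1) There exists a normal amenable subgroup $N\triangleleft\Gamma$ such that the stabilizer of $\mu$-almost every $x\in X$ is contained in $N$. (2) $\theta_{\boldsymbol a}^\infty$ is a non-atomic, self-normalizing, infinitely generated amenable invariant random subgroup, where $\theta_{\boldsymbol a}$ denotes the stabilizer distribution of $\boldsymbol a$.
   Context: A measure preserving (m.p.) action $\Gamma\curvearrowright^a(X,\mu)$ is a Borel action of $\Gamma$ on a standard probability space (possibly with atoms) preserving $\mu$; it is non-trivial if $\mu$ is not a point mass. It is NA-ergodic if its restriction to every non-amenable subgroup of $\Gamma$ is ergodic. $\Gamma_x=\{\gamma\in\Gamma:\gamma^ax=x\}$. $\mathrm{Sub}_\Gamma\subseteq2^\Gamma$ is the compact space of subgroups of $\Gamma$. An invariant random subgroup (IRS) is a conjugation-invariant Borel probability measure $\theta$ on $\mathrm{Sub}_\Gamma$. A property of subgroups is said to hold for $\theta$ if it holds for $\theta$-almost every subgroup; ''self-normalizing'' means $H$ equals its normalizer in $\Gamma$, and ''infinitely generated'' means not finitely generated. $\theta$ is non-atomic if it has no atoms as a measure. The stabilizer distribution $\theta_{\boldsymbol a}$ is the pushforward of $\mu$ under $x\mapsto\Gamma_x$; it is an IRS. For $H\le\Gamma$ let $N(H)$ be the normalizer of $H$ in $\Gamma$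 and define by transfinite recursion $N^0(H)=H$, $N^{\alpha+1}(H)=N(N^\alpha(H))$, and $N^\lambda(H)=\bigcup_{\alpha<\lambda}N^\alpha(H)$ for limit $\lambda$. For an IRS $\theta$ and countable ordinal $\alpha$ let $\theta^\alpha=(N^\alpha)_*\theta$. There is a countable ordinal $\alpha$ such that $\theta^\beta=\theta^\alpha$ for all countable $\beta\ge\alpha$; this eventual value is denoted $\theta^\infty$. *)

(* Defs.v *)
From HB Require Import structures.
From mathcomp Require Import all_boot all_order all_algebra.
From mathcomp Require Import all_classical all_reals all_analysis.
From mathcomp Require wochoice.

Set Implicit Arguments.
Unset Strict Implicit.
Unset Printing Implicit Defensive.

Import Order.TTheory GRing.Theory Num.Theory.
Local Open Scope classical_set_scope.
Local Open Scope ring_scope.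

Definition wo_nat_set : rel (set nat) :=
  sval (wochoice.well_ordering_principle (set nat)).

(* The elements of an uncountable well-ordered set that have countably many
   predecessors form a well-order of type omega_1 (lemmas [omega1_min],
   [omega1_countable_le] and [omega1_uncountable]), so an element of [omega1]
   is a countable ordinal. *)
Definition omega1 :=
  {x : set nat | countable [set y | wo_nat_set y x]}.

HB.instance Definition _ := Choice.on omega1.

Definition omega1_le (a b : omega1) : bool := wo_nat_set (val a) (val b).

Lemma wo_nat_setP : wochoice.well_order wo_nat_set.
Proof. exact: (svalP (wochoice.well_ordering_principle (set nat))). Qed.

Lemma wo_chainT : wochoice.wo_chain wo_nat_set predT.
Proof. by move=> A _; apply: wo_nat_setP. Qed.

Lemma wo_nat_set_refl : reflexive wo_nat_set.
Proof. by move=> x; apply: (wochoice.wo_chain_reflexive wo_chainT). Qed.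

Lemma wo_nat_set_anti : antisymmetric wo_nat_set.
Proof. by move=> x y; apply: (wochoice.wo_chain_antisymmetric wo_chainT). Qed.

Lemma wo_nat_set_total : total wo_nat_set.
Proof. by move=> x y; apply: (wochoice.wo_chainW wo_chainT). Qed.

Lemma wo_nat_set_min (A : set (set nat)) :
  A !=set0 -> exists2 x, A x & forall y, A y -> wo_nat_set x y.
Proof.
move=> [a Aa].
have [|z [[zA zmin] _]] := @wo_nat_setP (mem A).
  by exists a; apply/mem_set.
exists z; first exact: set_mem.
by move=> y Ay; apply: zmin; apply/mem_set.
Qed.

Lemma wo_nat_set_trans : transitive wo_nat_set.
Proof.
move=> y x z xy yz.
have [|w [->|->|->] wmin] := @wo_nat_set_min [set u | [\/ u = x, u = y | u = z]].
- by exists x; apply: Or31.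
- by apply: wmin; apply: Or33.
- have yx : wo_nat_set y x by apply: wmin; apply: Or31.
  by have <- : y = x by apply: wo_nat_set_anti; rewrite yx xy.
- have zy : wo_nat_set z y by apply: wmin; apply: Or32.
  by have <- : y = z by apply: wo_nat_set_anti; rewrite yz zy.
Qed.

Lemma omega1_le_refl : reflexive omega1_le.
Proof. by move=> x; apply: wo_nat_set_refl. Qed.

Lemma omega1_le_anti : antisymmetric omega1_le.
Proof. by move=> x y h; apply/val_inj/wo_nat_set_anti. Qed.

Lemma omega1_le_trans : transitive omega1_le.
Proof. by move=> y x z; apply: wo_nat_set_trans. Qed.

Lemma omega1_le_total : total omega1_le.
Proof. by move=> x y; apply: wo_nat_set_total. Qed.

Fact omega1_display : Order.disp_t. Proof. exact: Order.Disp tt tt. Qed.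

HB.instance Definition _ := Order.Le_isPOrder.Build omega1_display omega1
  omega1_le_refl omega1_le_anti omega1_le_trans.
HB.instance Definition _ := Order.POrder_isTotal.Build omega1_display omega1
  omega1_le_total.

Lemma omega1_min (A : set omega1) :
  A !=set0 -> exists2 a, A a & forall b, A b -> (a <= b)%O.
Proof.
move=> [a Aa].
have [|x [b Ab <-] bmin] := @wo_nat_set_min (val @` A).
  by exists (val a), a.
by exists b => // c Ac; apply: bmin; exists c.
Qed.

Lemma omega1_countable_le (a : omega1) :
  countable [set b : omega1 | (b <= a)%O].
Proof.
have /countable_injP[f finj] := valP a.
apply/countable_injP; exists (f \o val) => x y; rewrite !inE => xa ya fxy.
by apply/val_inj/finj; rewrite ?inE.
Qed.

Lemma omega1_uncountable : ~~ countable [set: omega1].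
Proof.
apply/negP => c1.
pose S := [set x : set nat | countable [set y | wo_nat_set y x]].
have cS : countable S.
  have -> : S = val @` [set: omega1].
    rewrite eqEsubset; split=> [x Sx|_ [x _ <-]]; last exact: (valP x).
    by exists (exist _ x Sx).
  exact: sub_countable (card_image_le _ _) c1.
have [ST|/existsNP[x0 nx0]] := pselect (forall x, S x).
  have /countable_injP[f finj] : countable [set: set nat].
    by apply: sub_countable cS; apply: subset_card_le => x _; apply: ST.
  pose D := [set n | exists2 A, f A = n & ~ A n].
  have [DD|nDD] := pselect (D (f D)); last by apply: (nDD); exists D.
  have [A fAD nA] := DD.
  by apply: nA; rewrite (finj A D) ?inE.
have [|x nx xmin] := @wo_nat_set_min (~` S); first by exists x0.
apply: nx; rewrite /S /=.
have sub : [set y | wo_nat_set y x] `<=` S `|` [set x].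
  move=> y yx; have [Sy|nSy] := pselect (S y); [by left|right].
  by apply: wo_nat_set_anti; rewrite yx (xmin _ nSy).
apply: sub_countable (subset_card_le sub) _.
by rewrite -bigcup2inE; apply: bigcup_countable => // -[|[|n]]//= _.
Qed.

Lemma omega1_wf : well_founded (fun a b : omega1 => (a < b)%O).
Proof.
move=> a; apply: contrapT => nAa.
have [|b nAb bmin] :=
    @omega1_min [set c | ~ Acc (fun a b : omega1 => (a < b)%O) c].
  by exists a.
apply: nAb; constructor => c cb; apply: contrapT => /bmin.
by rewrite leNgt cb.
Qed.

Definition is_succ (b a : omega1) : Prop :=
  (b < a)%O /\ forall c : omega1, (c < a)%O -> (c <= b)%O.

Section subgroups.
Variable G : groupType.

(* A subset of G is its indicator function G -> bool, so that Sub(G) carries the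
   subspace topology of the product 2^G. *)
Definition subgroups : set (prod_topology (fun _ : G => bool)) :=
  [set H : G -> bool | group_closed H].

Definition subgp : Type := set_type subgroups.

HB.instance Definition _ := Topological.on subgp.

Definition pred_of_subgp (H : subgp) : {pred G} := val H.

Definition mk_subgp (H : {pred G}) (cH : group_closed H) : subgp :=
  exist _ H (mem_set cH).

Lemma subgpP (H : subgp) : group_closed (pred_of_subgp H).
Proof. exact: (set_mem (valP H)). Qed.

Lemma trivial_group_closed : group_closed (pred1 (1%g : G)).
Proof.
by split=> [|x y]; rewrite !inE// => /eqP-> /eqP->; rewrite divg1.
Qed.

HB.instance Definition _ := isPointed.Build subgp (mk_subgp trivial_group_closed).

Definition borel_subgp := g_sigma_algebraType (@open subgp).

HB.instance Definition _ := Measurable.on borel_subgp.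

(* g H g^-1; recall that x ^ g = g^-1 * x * g in MathComp *)
Definition conj_pred (g : G) (H : {pred G}) : {pred G} :=
  [pred x | (x ^ g)%g \in H].

Lemma conj_pred_closed g H : group_closed H -> group_closed (conj_pred g H).
Proof.
move=> [H1 HB]; split=> [|x y]; rewrite !inE ?conj1g// => xH yH.
by rewrite conjMg conjVg HB.
Qed.

Definition conj_subgp (g : G) (H : subgp) : subgp :=
  mk_subgp (conj_pred_closed g (subgpP H)).

Definition normalizer (H : {pred G}) : {pred G} :=
  [pred g | `[< conj_pred g H =i H >]].

Lemma normalizerP g (H : {pred G}) :
  reflect (conj_pred g H =i H) (g \in normalizer H).
Proof. exact: asboolP. Qed.

Lemma normalizer_closed H : group_closed (normalizer H).
Proof.
split=> [|x y].
  by apply/normalizerP => h; rewrite !inE conjg1.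
move=> /normalizerP xN /normalizerP yN; apply/normalizerP => h.
rewrite !inE conjgM -[RHS]xN inE.
by rewrite -[LHS]yN inE conjgKV.
Qed.

Lemma normalizer_sub (H : {pred G}) :
  group_closed H -> {subset H <= normalizer H}.
Proof.
move=> cH x xH; apply/normalizerP => h; rewrite !inE.
have HM := group_closedM cH; have HV := group_closedV cH.
apply/idP/idP => hH; last by rewrite conjgE !HM// HV.
have -> : h = (x * (h ^ x) * x^-1)%g by rewrite conjgE !mulgA mulgV mul1g mulgK.
by apply: (HM); [apply: (HM)|apply: HV].
Qed.

(* [iter_normalizer a H] is N^a(H); its three recursion clauses are lemmas
   [iter_normalizer0], [iter_normalizerS] and [iter_normalizer_lim]. *)
Definition iter_normalizer_step (H : {pred G}) (a : omega1)
    (rec : forall b : omega1, (b < a)%O -> {pred G}) : {pred G} :=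
  match pselect (exists b, is_succ b a) with
  | left ex => let: exist b bP := cid ex in normalizer (rec b bP.1)
  | right _ =>
      if `[< exists b : omega1, (b < a)%O >]
      then fun g => `[< exists (b : omega1) (ba : (b < a)%O), g \in rec b ba >]
      else H
  end.

Definition iter_normalizer (a : omega1) (H : {pred G}) : {pred G} :=
  Fix omega1_wf (fun=> {pred G}) (iter_normalizer_step H) a.

Lemma iter_normalizerE a H : iter_normalizer a H =
  iter_normalizer_step H (fun b (_ : (b < a)%O) => iter_normalizer b H).
Proof.
rewrite /iter_normalizer Fix_eq// => {}a f g fg; congr iter_normalizer_step.
by apply: functional_extensionality_dep => b;
  apply: functional_extensionality_dep => ba; apply: fg.
Qed.

Lemma iter_normalizer0 a H :
  (forall b : omega1, (a <= b)%O) -> iter_normalizer a H = H.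
Proof.
move=> amin; rewrite iter_normalizerE /iter_normalizer_step.
case: pselect => [ex|_].
  by exfalso; have [b [ba _]] := ex; move: (amin b); rewrite leNgt ba.
by case: asboolP => // -[b ba]; move: (amin b); rewrite leNgt ba.
Qed.

Lemma iter_normalizerS a b H :
  is_succ b a -> iter_normalizer a H = normalizer (iter_normalizer b H).
Proof.
move=> [ba bmax]; rewrite iter_normalizerE /iter_normalizer_step.
case: pselect => [ex|[]]; last by exists b.
case: cid => c [ca cmax] /=.
by have -> : c = b by apply/le_anti; rewrite bmax// cmax.
Qed.

Lemma iter_normalizer_lim a H :
    (exists b : omega1, (b < a)%O) -> ~ (exists b, is_succ b a) ->
  forall g, g \in iter_normalizer a H <->
    exists2 b : omega1, (b < a)%O & g \in iter_normalizer b H.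
Proof.
move=> exb nsucc g; rewrite iter_normalizerE /iter_normalizer_step.
case: pselect => // _; case: asboolP => // _; split.
  by rewrite -topredE => /asboolP[b [ba gb]]; exists b.
by move=> [b ba gb]; rewrite -topredE; apply/asboolP; exists b, ba.
Qed.

Lemma iter_normalizer_closed_mono a (H : {pred G}) : group_closed H ->
  group_closed (iter_normalizer a H) /\
  forall b : omega1, (b <= a)%O -> {subset iter_normalizer b H <= iter_normalizer a H}.
Proof.
move=> cH; elim/(well_founded_ind omega1_wf) : a => a IH.
suff [cN sub] : group_closed (iter_normalizer a H) /\ forall b : omega1, (b < a)%O ->
    {subset iter_normalizer b H <= iter_normalizer a H}.
  by split=> // b; rewrite le_eqVlt => /predU1P[->//|]; apply: sub.
have [[b sba]|nsucc] := pselect (exists b, is_succ b a).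
  have [ba bmax] := sba; have [cb subb] := IH _ ba.
  rewrite (iter_normalizerS _ sba); split; first exact: normalizer_closed.
  by move=> c ca x xc; apply: normalizer_sub => //; apply: (subb _ (bmax _ ca)).
have [exb|nexb] := pselect (exists b : omega1, (b < a)%O); last first.
  rewrite iter_normalizer0 => [|b]; last first.
    by rewrite leNgt; apply/negP => ba; apply: nexb; exists b.
  by split=> // b ba; case: nexb; exists b.
have limE := iter_normalizer_lim H exb nsucc.
split; last by move=> b ba x xb; apply/limE; exists b.
split; first by have [b ba] := exb; apply/limE; exists b => //; have [[]] := IH _ ba.
move=> x y /limE[b ba xb] /limE[c ca yc]; apply/limE.
have [bc|cb] := leP b c.
- exists c => //; have [[_ cD] sub] := IH _ ca.
  by apply: cD => //; apply: sub bc _ _.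
- exists b => //; have [[_ bD] sub] := IH _ ba.
  by apply: bD => //; apply: sub (ltW cb) _ _.
Qed.

Definition iter_normalizer_subgp (a : omega1) (H : subgp) : subgp :=
  mk_subgp (iter_normalizer_closed_mono a (subgpP H)).1.

Definition self_normalizing (H : {pred G}) : Prop := normalizer H =i H.

Definition normal_subgroup (N : {pred G}) : Prop :=
  group_closed N /\ forall g, conj_pred g N =i N.

Definition finitely_generated (H : {pred G}) : Prop :=
  exists2 s : seq G, {subset s <= H} &
    forall K : {pred G}, group_closed K -> {subset s <= K} -> {subset H <= K}.

(* von Neumann amenability: H carries a finitely additive, left-invariant
   probability measure defined on all of its subsets. *)
Definition amenable (R : realType) (H : {pred G}) : Prop :=
  exists m : set G -> R, [/\ m [set` H] = 1,
    forall A, A `<=` [set` H] -> 0 <= m A,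
    forall A B, A `<=` [set` H] -> B `<=` [set` H] -> A `&` B = set0 ->
      m (A `|` B) = m A + m B &
    forall h A, h \in H -> A `<=` [set` H] ->
      m [set (h * x)%g | x in A] = m A].

End subgroups.

Coercion pred_of_subgp : subgp >-> pred_sort.

Section invariant_random_subgroups.
Variables (R : realType) (G : groupType).

Definition is_IRS (theta : probability (borel_subgp G) R) : Prop :=
  forall (g : G) (A : set (borel_subgp G)), measurable A ->
    theta (conj_subgp g @^-1` A) = theta A.

(* The maps N^a and x |-> stab x are Borel, so that the raw set functions
   [theta_pow theta a] and [stab_distribution a] agree with genuine probability
   measures on the Borel sets of Sub(G); off the Borel sets they carry no
   information, hence measures on Sub(G) are compared on Borel sets only. *)
Definition theta_pow (theta : set (borel_subgp G) -> \bar R) (a : omega1) :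
    set (borel_subgp G) -> \bar R :=
  pushforward theta (iter_normalizer_subgp a : borel_subgp G -> borel_subgp G).

(* nu is the eventual value theta^oo of the transfinite sequence theta^a. *)
Definition is_theta_infty (theta : set (borel_subgp G) -> \bar R)
    (nu : probability (borel_subgp G) R) : Prop :=
  exists a : omega1, forall b : omega1, (a <= b)%O ->
    forall A, measurable A -> theta_pow theta b A = nu A.

End invariant_random_subgroups.

Section measures.
Variables (R : realType) (d : measure_display) (X : measurableType d).

Definition nonatomic (mu : probability X R) : Prop :=
  ~ exists A, [/\ measurable A, (0 < mu A)%E &
      forall B, measurable B -> B `<=` A -> mu B = 0%E \/ mu B = mu A].

Definition point_mass (mu : probability X R) : Prop :=
  exists x, forall A, measurable A -> mu A = \d_x A.

(* X is Borel isomorphic to a Polish space; a Hausdorff pseudometric space in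
   the sense of MathComp-Analysis is metrizable. *)
Definition standard_borel : Prop :=
  exists (T : completePseudoMetricType R) (f : X -> T),
    [/\ hausdorff_space T,
       exists2 D : set T, countable D & dense D,
       bijective f &
       forall A : set X, measurable A <-> <<s @open T >> (f @` A)].

End measures.

Section actions.
Variables (R : realType) (G : groupType) (d : measure_display).
Variables (X : measurableType d) (mu : probability X R).

Record mp_action := MpAction {
  act :> G -> X -> X ;
  act1 : forall x, act 1%g x = x ;
  actM : forall g h x, act (g * h)%g x = act g (act h x) ;
  measurable_act : forall g, measurable_fun [set: X] (act g) ;
  measure_act : forall g A, measurable A -> mu (act g @^-1` A) = mu A
}.

Definition stab_pred (a : mp_action) (x : X) : {pred G} :=
  [pred g | a g x == x].

Lemma stab_closed a x : group_closed (stab_pred a x).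
Proof.
split=> [|g h]; rewrite !inE; first by rewrite act1.
move=> /eqP gx /eqP hx; have hVx : a h^-1%g x = x.
  by rewrite -{1}hx -actM mulVg act1.
by rewrite actM hVx gx.
Qed.

Definition stab (a : mp_action) (x : X) : subgp G := mk_subgp (stab_closed a x).

Definition stab_distribution (a : mp_action) : set (borel_subgp G) -> \bar R :=
  pushforward mu (stab a : X -> borel_subgp G).

Definition ergodic_on (a : mp_action) (H : {pred G}) : Prop :=
  forall A, measurable A -> {in H, forall h, a h @^-1` A = A} ->
    mu A = 0%E \/ mu A = 1%E.

Definition NA_ergodic (a : mp_action) : Prop :=
  forall H : {pred G}, group_closed H -> ~ amenable R H -> ergodic_on a H.

End actions.

(* Main.v *)
Require Import Defs.
From HB Require Import structures.
From mathcomp Require Import all_boot all_order all_algebra.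
From mathcomp Require Import all_classical all_reals all_analysis.
From mathcomp Require Import lra.

(* The engine is the following zero-one argument. If K is a non-amenable subgroup
   and B a non-null K-invariant set, then B has full measure; if moreover the
   members of a countable family of sets have K-invariant traces on B, they have
   measure 0 or 1, so almost all points of X lie in the same members.

   For B = {x | K <= G_x} and a family separating the points of X, mu would be a
   point mass. Hence no finitely generated non-amenable subgroup stabilizes a
   non-null set of points, and G_x is amenable almost surely, an increasing union
   of amenable groups being amenable. For an equivariant map phi from X to
   subgroups, B = {x | K <= N(phi x)} and the sets {x | g \in phi x}, phi would be
   almost surely constant. By transfinite induction, N^al(G_x) is therefore
   amenable almost surely as long as no earlier x |-> N^be(G_x) is almost surely
   constant.

   If some N^al(G_x) is almost surely constant, then for the least such al its
   value is a normal amenable subgroup containing almost all stabilizers. If not,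
   theta^oo is an amenable self-normalizing IRS. An atom H of it would have
   finitely many conjugates, so that H = N(H) would be an amenable subgroup of
   finite index and G would be amenable; in that case N = G works. As there are
   only countably many finitely generated subgroups, a non-atomic IRS is almost
   surely infinitely generated. *)

Set Implicit Arguments.
Unset Strict Implicit.
Unset Printing Implicit Defensive.

Import Order.TTheory GRing.Theory Num.Theory.
Import numFieldNormedType.Exports.
Local Open Scope classical_set_scope.
Local Open Scope ring_scope.

(** * Means on subgroups *)

Section subgroup_predicates.
Variable G : groupType.
Implicit Types (H K : {pred G}) (s : seq G).

Lemma eq_pred H K : H =i K -> H = K.
Proof. by move=> HK; apply/funext => x; apply: HK. Qed.

Definition gen s : {pred G} :=
  [pred g | `[< forall K, group_closed K -> {subset s <= K} -> g \in K >]].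

Lemma genP s g :
  reflect (forall K, group_closed K -> {subset s <= K} -> g \in K)
          (g \in gen s).
Proof. exact: asboolP. Qed.

Lemma gen_closed s : group_closed (gen s).
Proof.
split=> [|x y /genP xs /genP ys]; apply/genP => K cK sK; first by case: cK.
by case: (cK) => _; apply; [apply: xs|apply: ys].
Qed.

Lemma sub_gen s : {subset s <= gen s}.
Proof. by move=> x xs; apply/genP => K _; apply. Qed.

Lemma gen_sub s K : group_closed K -> {subset s <= K} -> {subset gen s <= K}.
Proof. by move=> cK sK x /genP; apply. Qed.

Lemma mulg_memr H h x : group_closed H -> h \in H -> ((h * x)%g \in H) = (x \in H).
Proof.
move=> cH hH; apply/idP/idP => xH; last exact: group_closedM.
rewrite -(mulKg h x); apply: group_closedM => //; exact: group_closedV.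
Qed.

End subgroup_predicates.

Section amenability.
Variables (R : realType) (G : groupType).
Implicit Types H : {pred G}.

Lemma translateE (h : G) (A : set G) :
  [set (h * x)%g | x in A] = [set y | A (h^-1 * y)%g].
Proof.
apply/seteqP; split => [_ [x Ax <-]|y Ay] /=; first by rewrite mulKg.
by exists (h^-1 * y)%g => //; rewrite mulVKg.
Qed.

Definition mean_on H (m : set G -> R) := [/\ m [set` H] = 1,
    forall A, A `<=` [set` H] -> 0 <= m A,
    forall A B, A `<=` [set` H] -> B `<=` [set` H] -> A `&` B = set0 ->
      m (A `|` B) = m A + m B &
    forall h A, h \in H -> A `<=` [set` H] ->
      m [set (h * x)%g | x in A] = m A].

Lemma mean_le1 H m A : mean_on H m -> A `<=` [set` H] -> m A <= 1.
Proof.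
move=> [m1 m0 mU _] AH; rewrite -m1.
have -> : [set` H] = A `|` ([set` H] `\` A) by rewrite setDUK.
rewrite mU ?setDIK// lerDl; exact: m0.
Qed.

Lemma nat_ultrafilter :
  exists F : set_system nat, UltraFilter F /\ \oo `<=` F.
Proof. exact: (@ultraFilterLemma _ \oo). Qed.

(** Compactness of [0, 1] gives a cluster point, and for an ultrafilter a cluster point is a
    limit. *)
Lemma ultra_cvg01 (F : set_system nat) (u : nat -> R) :
  UltraFilter F -> (forall n, 0 <= u n <= 1) ->
  exists l : R, 0 <= l <= 1 /\ u @ F --> l.
Proof.
move=> UF u01; have FF : ProperFilter F by exact: ultra_proper.
have [|l [l01 ul]] := @segment_compact R 0 1 (u @ F) _.
  suff : F (u @^-1` `[0, 1]) by [].
  rewrite (_ : _ @^-1` _ = setT); first exact: filterT.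
  by apply/seteqP; split => // n _ /=; rewrite in_itv /= u01.
exists l; split; first by move: l01; rewrite /= in_itv.
move=> V Vl; have [//|FV] := in_ultra_setVsetC (u @^-1` V) UF.
have [//|x []] := ul (~` V) V _ Vl.
by [].
Qed.

(* The mean on H is an ultralimit of means on the increasing subgroups generated
   by the elements of H among e 0, ..., e (n - 1). *)
Lemma amenable_gen H (e : nat -> G) : (forall g, exists n, e n = g) ->
  group_closed H ->
  (forall s, {subset s <= H} -> amenable R (gen s)) -> amenable R H.
Proof.
move=> esurj cH amH.
pose t n := [seq x <- [seq e i | i <- iota 0 n] | x \in H].
have tH n : {subset t n <= H} by move=> x; rewrite mem_filter => /andP[].
have genH n : [set` gen (t n)] `<=` [set` H].
  by move=> x; apply: gen_sub.
have [m mP] := choice (fun n => amH _ (tH n)).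
have [F [UF Foo]] := nat_ultrafilter.
pose u A n := m n (A `&` [set` gen (t n)]).
have subI A n : A `&` [set` gen (t n)] `<=` [set` gen (t n)].
  by move=> x [].
have u01 A n : 0 <= u A n <= 1.
  have [m1 m0 _ _] := mP n; apply/andP; split; first exact: m0.
  exact: (mean_le1 (mP n)).
have [M MP] := choice (fun A => ultra_cvg01 UF (u01 A)).
have FF : ProperFilter F by exact: ultra_proper.
have lim_unique (v : nat -> R) (l l' : R) : v @ F --> l -> v @ F --> l' -> l = l'.
  by move=> vl vl'; apply: (cvg_unique _ vl vl').
exists M; split=> [|A _|A B AH BH AB0|h A hH AH].
- apply: (lim_unique (u [set` H])); first by case: (MP [set` H]).
  have -> : u [set` H] = fun=> 1; last exact: cvg_cst.
  by apply/funext => n; rewrite /u setIidr//; case: (mP n).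
- by case: (MP A) => /andP[].
- apply: (lim_unique (u (A `|` B))); first by case: (MP (A `|` B)).
  have -> : u (A `|` B) = u A \+ u B.
    apply/funext => n /=; rewrite /u setIUl; have [_ _ mU _] := mP n.
    by rewrite mU// setIACA AB0 set0I.
  by apply: cvgD; [case: (MP A)|case: (MP B)].
- apply: (lim_unique (u [set (h * x)%g | x in A])).
    by case: (MP [set (h * x)%g | x in A]).
  (* If h = e k, then h lies in [gen (t n)] for all n > k, so the trace of hA there is the
     h-translate of the trace of A. As F refines [\oo], the other n do not affect the limit. *)
  apply: cvg_trans (MP A).2; apply: near_eq_cvg; apply: Foo.
  have [k ek] := esurj h; exists k.+1 => // n kn /=.
  have ht : h \in gen (t n).
    apply: sub_gen; rewrite mem_filter hH -ek map_f// mem_iota//.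
  have [_ _ _ mI] := mP n.
  rewrite /u -[LHS](mI h)//; congr (m n _).
  rewrite !translateE; apply/seteqP; split=> y /=;
    rewrite mulg_memr//;
      [exact: gen_closed|exact: group_closedV (gen_closed _) _ ht|
       exact: gen_closed|exact: group_closedV (gen_closed _) _ ht].
Qed.

End amenability.

Section subgroup_space.
Variable G : groupType.
Implicit Types (H K : subgp G) (g h : G).

Lemma subgp_eq H K : H =i K -> H = K.
Proof. by move=> HK; apply/val_inj/eq_pred. Qed.

Lemma mem_conj_subgp g H x : (x \in conj_subgp g H) = ((x ^ g)%g \in H).
Proof. by []. Qed.

Lemma conj_subgpM g h H : conj_subgp (g * h)%g H = conj_subgp g (conj_subgp h H).
Proof. by apply: subgp_eq => x; rewrite !mem_conj_subgp conjgM. Qed.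

Lemma conj_subgp1 H : conj_subgp 1%g H = H.
Proof. by apply: subgp_eq => x; rewrite mem_conj_subgp conjg1. Qed.

Lemma conj_subgpK g : cancel (conj_subgp g) (conj_subgp g^-1%g).
Proof. by move=> H; rewrite -conj_subgpM mulVg conj_subgp1. Qed.

Lemma conj_subgpVK g : cancel (conj_subgp g^-1%g) (conj_subgp g).
Proof. by move=> H; rewrite -conj_subgpM mulgV conj_subgp1. Qed.

Lemma normalizer_conjE g H : (g \in normalizer H) <-> conj_subgp g H = H.
Proof.
split=> [/normalizerP gH|gH]; first exact: subgp_eq.
by apply/normalizerP => x; rewrite -[in RHS]gH.
Qed.

(* As H = N(H), the cosets of H correspond to its conjugates; a mean on G is the
   average over these finitely many cosets of the translated mean of H. *)
Lemma amenable_finite_conj (R : realType) H :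
  finite_set [set conj_subgp g H | g in [set: G]] -> self_normalizing H ->
  amenable R H -> amenable R (predT : {pred G}).
Proof.
move=> /finite_seqP[s0 s0E] sH [m [m1 m0 mU mI]].
(* Each conjugate is listed once, so that conjugation by h permutes [s]. *)
pose s := undup s0.
have sP K : K \in s <-> exists g, conj_subgp g H = K.
  have -> : (K \in s) = (K \in s0) by rewrite mem_undup.
  split=> [Ks|[g gK]].
    by have : [set` s0] K by []; rewrite -s0E => -[g _ gK]; exists g.
  suff : [set` s0] K by [].
  by rewrite -s0E; exists g.
have /choice[r rP] : forall K, exists g, K \in s -> conj_subgp g H = K.
  move=> K; have [/sP[g gK]|nK] := boolP (K \in s).
    by exists g.
  by exists 1%g.
(* The mass of A on the coset gH, carried back to H. *)
pose F (A : set G) g := m [set x | x \in H /\ A (g * x)%g].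
have subH A g : [set x | x \in H /\ A (g * x)%g] `<=` [set` H] by move=> x [].
(* If g1 and g2 conjugate H to the same subgroup, then g2^-1 g1 lies in N(H) = H, under which [m] is
   invariant. *)
have Fconj A g1 g2 : conj_subgp g1 H = conj_subgp g2 H -> F A g1 = F A g2.
  move=> g12; have hH : (g2^-1 * g1)%g \in H.
    by rewrite -sH; apply/normalizer_conjE; rewrite conj_subgpM g12 conj_subgpK.
  rewrite /F -[LHS](mI (g2^-1 * g1)%g)//; congr m.
  have VH := group_closedV (subgpP H) hH.
  have gV x : (g1 * ((g2^-1 * g1)^-1 * x))%g = (g2 * x)%g.
    by rewrite invgM invgK !mulgA mulgV mul1g.
  by rewrite translateE; apply/seteqP; split=> x /=;
    rewrite gV (mulg_memr _ (subgpP H) VH).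
have shiftF A g h : F [set (h * x)%g | x in A] g = F A (h^-1 * g)%g.
  rewrite /F translateE; congr m; apply/seteqP; split=> x /= [xH];
  by rewrite ?mulgA// -?mulgA.
have s_gt0 : (0 < size s)%N.
  have : H \in s by apply/sP; exists 1%g; rewrite conj_subgp1.
  by case: (s).
have s_neq0 : (size s)%:R != 0 :> R by rewrite pnatr_eq0 -lt0n.
exists (fun A => (size s)%:R^-1 * \sum_(K <- s) F A (r K)); split.
- rewrite (eq_bigr (fun=> 1)); last first.
    move=> K _; rewrite /F -[RHS]m1; congr m.
    by apply/seteqP; split=> x //= [].
  by rewrite big_const_seq count_predT iter_addr addr0 mulVf.
- move=> A _; rewrite mulr_ge0// ?invr_ge0// sumr_ge0// => K _.
  exact: m0.
- move=> A B _ _ AB; rewrite -mulrDr -big_split /=; congr (_ * _).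
  apply: eq_bigr => K _; rewrite /F -mU//.
    by congr m; apply/seteqP; split=> x; rewrite /setU /=; tauto.
  apply/seteqP; split=> x //= [[_ Ax] [_ Bx]].
  by have : (A `&` B) (r K * x)%g by []; rewrite AB.
- move=> h A _ _; congr (_ * _).
  have pe : perm_eq [seq conj_subgp h^-1%g K | K <- s] s.
    apply: uniq_perm; rewrite ?undup_uniq//.
      by rewrite map_inj_uniq ?undup_uniq//; apply: can_inj (conj_subgpVK h).
    move=> K; apply/mapP/idP => [[L /sP[g <-] ->]|/sP[g <-]].
      by apply/sP; exists (h^-1 * g)%g; rewrite conj_subgpM.
    exists (conj_subgp h (conj_subgp g H)); last by rewrite conj_subgpK.
    by apply/sP; exists (h * g)%g; rewrite conj_subgpM.
  rewrite -[RHS](perm_big _ pe) big_map /= !big_seq; apply: eq_bigr => K Ks.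
  rewrite shiftF; apply: Fconj; rewrite conj_subgpM !rP//.
  have /sP[g <-] := Ks.
  by apply/sP; exists (h^-1 * g)%g; rewrite conj_subgpM.
Qed.

End subgroup_space.

(** * Measures and the Borel space of subgroups *)

Lemma countable_enumeration (T : Type) (A : set T) : countable A -> A !=set0 ->
  exists2 u : nat -> T, (forall n, A (u n)) & forall x, A x -> exists n, u n = x.
Proof.
move=> /countable_injP[h hinj] [x0 Ax0].
have /choice[u uP] : forall n, exists x, A x /\ forall y, A y -> h y = n -> y = x.
  move=> n; have [[x [Ax xn]]|nx] := pselect (exists x, A x /\ h x = n).
    by exists x; split=> // y Ay yn; apply: hinj; rewrite ?inE// xn.
  by exists x0; split=> // y Ay yn; case: nx; exists y.
exists u => [n|x Ax]; first by case: (uP n).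
by exists (h x); rewrite -((uP (h x)).2 x).
Qed.

(** Pull back the interiors of balls of radius 1/(m+1) centred in a countable dense set; a ball
    itself need not be open. Distinct points have disjoint balls, and a small enough basic set
    around the first point stays in its ball. *)
Lemma standard_borel_separating (R : realType) (d : measure_display)
    (X : measurableType d) : standard_borel R X ->
  exists U : nat -> set X, (forall k, measurable (U k)) /\
    forall x y, (forall k, U k x <-> U k y) -> x = y.
Proof.
move=> [T [f [hT [D cD dD] [g fK gK] mf]]].
have D0 : D !=set0.
  by have [y [_ Dy]] := dD setT (ex_intro _ (f point) I) openT; exists y.
have [t _ tD] := countable_enumeration cD D0.
pose B (nm : nat * nat) : set T := (ball (t nm.1) nm.2.+1%:R^-1)^°.
exists (fun k => if unpickle k is Some nm then f @^-1` B nm else set0); split.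
  move=> k; case: unpickle => // nm; apply/mf; apply: sub_sigma_algebra.
  rewrite image_preimage; first exact: open_interior.
  by apply/seteqP; split=> // y _; exists (g y) => //; rewrite gK.
move=> x y xy; apply: contrapT => nxy.
have := hT; rewrite ball_hausdorff => /(_ (f x) (f y)).
case=> [|[r1 r2] /= /eqP r12]; first by apply/eqP => /(can_inj fK).
have [m mr] : exists m : nat, (2 * m.+1%:R^-1 < r1%:num).
  have r1_gt0 : (0 < r1%:num / 2) by rewrite divr_gt0.
  have [m _ /(_ m (leqnn m))] := near_infty_natSinv_lt (PosNum r1_gt0).
  by move=> /= h; exists m; rewrite mulrC -ltr_pdivlMr.
pose eps : R := m.+1%:R^-1.
have e0 : (0 < eps / 2) by rewrite divr_gt0// invr_gt0.
have xn : (ball (f x) (eps / 2))^° (f x) by exact: nbhsx_ballx.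
have [t' [xt' Dt']] := dD _ (ex_intro _ _ xn) (@open_interior _ _).
have [n nt'] := tD _ Dt'.
have xt : ball (f x) (eps / 2) (t n) by rewrite nt'; apply: interior_subset.
have Bx : B (n, m) (f x).
  suff : nbhs (f x) (ball (t n) eps) by [].
  apply: filterS (nbhsx_ballx (f x) _ e0) => z xz.
  by rewrite (splitr eps); apply: ball_triangle xz; apply: ball_sym.
have /= := xy (pickle (n, m)); rewrite pickleK => -[/(_ Bx) /interior_subset yt _].
have yr : ball (f x) r1%:num (f y).
  apply: (@le_ball _ _ _ (eps / 2 + eps)).
    have := ltW mr; rewrite -/eps; lra.
  exact: ball_triangle xt yt.
have : (ball (f x) r1%:num `&` ball (f y) r2%:num) (f y).
  by split=> //; apply: ballxx.
by rewrite r12.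
Qed.

(** * Zero-one sets and almost sure constancy *)

Section zero_one.
Variables (R : realType) (d : measure_display) (X : measurableType d).
Variable mu : probability X R.
Local Open Scope ereal_scope.

Lemma measure_bigcup0 (F : nat -> set X) :
  (forall k, measurable (F k)) -> (forall k, mu (F k) = 0) ->
  mu (\bigcup_k F k) = 0.
Proof.
move=> mF F0; apply/negligibleP; first exact: bigcupT_measurable.
by apply: negligible_bigcup => k; apply: (negligibleP mu (mF k)).2; exact: F0.
Qed.

Lemma probability_setD (A B : set X) : measurable A -> measurable B ->
  mu (A `\` B) = mu A - mu (A `&` B).
Proof.
by move=> mA mB; rewrite measureD// ltey_eq fin_num_measure.
Qed.

Lemma measure_setD0 (A N : set X) : measurable A -> measurable N ->
  mu N = 0 -> mu (A `\` N) = mu A.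
Proof.
move=> mA mN N0; rewrite probability_setD//.
rewrite [X in _ - X](_ : _ = 0) ?sube0//.
by apply: subset_measure0 N0 => //; exact: measurableI.
Qed.

(** Each [U k] or its complement fills B up to a null set. Off the union of these null sets all
    points of B lie in the same [U k], and any of them serves as x0. *)
Lemma zero_one_point (B : set X) (U : nat -> set X) :
  measurable B -> (forall k, measurable (U k)) -> 0 < mu B ->
  (forall k, mu (B `&` U k) = 0 \/ mu (B `&` U k) = mu B) ->
  exists2 x0, B x0 &
    let C := [set x | B x /\ forall k, U k x <-> U k x0] in
    measurable C /\ mu C = mu B.
Proof.
move=> mB mU B0 UB.
have mW (P : Prop) k : measurable (if `[< P >] then U k else ~` U k).
  by case: ifP => _ //; apply: measurableC.
pose V k := if `[< mu (B `&` U k) = mu B >] then U k else ~` U k.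
pose N := \bigcup_k (B `\` V k).
have mN : measurable N.
  by apply: bigcupT_measurable => k; apply: measurableD => //; apply: mW.
have N0 : mu N = 0.
  apply: measure_bigcup0 => k; first by apply: measurableD => //; apply: mW.
  rewrite /V; case: asboolP => [UkB|nUkB].
    by rewrite probability_setD// UkB subee// fin_num_measure.
  by rewrite setDE setCK; case: (UB k).
have BN : mu (B `\` N) = mu B by exact: measure_setD0.
have [x0 [Bx0 Nx0]] : B `\` N !=set0.
  by apply/set0P/eqP => BN0; move: B0; rewrite -BN BN0 measure0 ltxx.
have VE x k : B x -> ~ N x -> V k x.
  by move=> Bx Nx; apply: contrapT => nV; apply: Nx; exists k.
exists x0 => //= ; set C := [set x | _].
have CE : C = B `&` \bigcap_k (if `[< U k x0 >] then U k else ~` U k).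
  apply/seteqP; split=> x [Bx xC]; split=> // k.
    by move=> _; case: asboolP; rewrite /setC /= xC.
  by have := xC k I; case: asboolP; split.
have mC : measurable C.
  rewrite CE; apply: measurableI => //.
  by apply: bigcapT_measurable => k; apply: mW.
split=> //; apply/eqP; rewrite eq_le; apply/andP; split.
  by apply: le_measure; rewrite ?inE// => x [].
rewrite -BN; apply: le_measure; rewrite ?inE//; first exact: measurableD.
move=> x [Bx Nx]; split=> // k.
have := VE _ k Bx Nx; have := VE _ k Bx0 Nx0; rewrite /V.
by case: ifP.
Qed.

End zero_one.

(** * The Borel structure of the space of subgroups *)

Section borel_subgroups.
Variables (G : groupType) (e : nat -> G).
Hypothesis e_surj : forall g, exists n, e n = g.

Lemma open_mem_subgp g : open [set H : subgp G | g \in H].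
Proof.
pose p (f : prod_topology (fun _ : G => bool)) : bool := f g.
have cp : continuous p by exact: (@proj_continuous G (fun=> bool) g).
have cv : continuous (set_val : subgp G -> prod_topology (fun _ : G => bool)).
  exact: initial_continuous.
have /continuousP/(_ [set true]) : continuous (p \o (set_val : subgp G -> _)).
  by move=> H; apply: continuous_comp; [apply: cv|apply: cp].
by move=> /(_ (discrete_open _)).
Qed.

Lemma measurable_mem_subgp g :
  measurable ([set H : subgp G | g \in H] : set (borel_subgp G)).
Proof. by apply: sub_sigma_algebra; apply: open_mem_subgp. Qed.

(* Otherwise subgroups K n outside U agreeing with H on e 0, ..., e (n - 1) would
   converge to H. *)
Lemma open_subgp_cylinder (U : set (subgp G)) (H : subgp G) : open U -> U H ->
  exists n, forall K : subgp G,
    (forall i, (i < n)%N -> (e i \in K) = (e i \in H)) -> U K.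
Proof.
move=> [W oW <-] /= WH; apply: contrapT => /forallNP noK.
have /choice[K KP] : forall n, exists K : subgp G,
    (forall i, (i < n)%N -> (e i \in K) = (e i \in H)) /\ ~ W (set_val K).
  move=> n; have /existsNP[K /not_implyP[KH nWK]] := noK n.
  by exists K.
have KW : (fun n => set_val (K n)) @ \oo -->
    (set_val H : prod_topology (fun _ : G => bool)).
  apply/cvg_sup => g A; rewrite nbhsE => -[_ [[B oB <-] /= BH] BA].
  have [i ig] := e_surj g.
  exists i.+1 => // n /= ni; apply: BA; rewrite /= -ig.
  have -> : set_val (K n) (e i) = set_val H (e i) by apply: (KP n).1.
  by rewrite ig.
have [n _ /(_ n (leqnn n))] := KW W (open_nbhs_nbhs (conj oW WH)).
exact: (KP n).2.
Qed.

(** An open set is a union of cylinders prescribing the membership of e 0, ..., e (n - 1). Finite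
    words of bits index them, so the union is countable and the coordinates suffice. *)
Lemma measurable_fun_subgp (d : measure_display) (X : measurableType d)
    (phi : X -> borel_subgp G) :
  (forall g, measurable [set x | g \in (phi x : subgp G)]) ->
  measurable_fun [set: X] phi.
Proof.
move=> mphi.
refine (@measurability _ _ X (borel_subgp G) _ phi (@open (subgp G)) _ _) => //.
move=> _ [U oU <-]; rewrite setTI.
pose cyl (w : seq bool) :=
  [set H : subgp G | forall i, (i < size w)%N -> (e i \in H) = nth false w i].
have -> : phi @^-1` U = \bigcup_(w in [set w | cyl w `<=` U]) (phi @^-1` cyl w).
  apply/seteqP; split=> [x /= Ux|x [w /= wU]]; last exact: wU.
  have [n nU] := open_subgp_cylinder oU Ux.
  exists [seq e i \in (phi x : subgp G) | i <- iota 0 n] => [K cK|i].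
    apply: nU => i ni; rewrite cK ?size_map ?size_iota//.
    by rewrite (nth_map 0%N) ?size_iota// nth_iota.
  rewrite size_map size_iota => ni.
  by rewrite (nth_map 0%N) ?size_iota// nth_iota.
rewrite bigcup_mkcond; apply: countable_bigcupT_measurable => // w.
case: ifP => // _.
have -> : phi @^-1` cyl w =
    \bigcap_i [set x | (i < size w)%N ->
                        (e i \in (phi x : subgp G)) = nth false w i].
  by apply/seteqP; split=> x xw i; [move=> _; apply: xw|apply: xw].
apply: bigcapT_measurable => i; case: ltnP => iw.
  have [wi|wi] := boolP (nth false w i).
    by rewrite [X in measurable X](_ : _ = [set x | e i \in (phi x : subgp G)])//;
      apply/seteqP; split=> x; [apply|move=> + _; apply].
  rewrite [X in measurable X](_ : _ = ~` [set x | e i \in (phi x : subgp G)]).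
    exact: measurableC.
  by apply/seteqP; split=> x /=; [move=> /(_ isT) ->|move=> /negP/negbTE].
by rewrite [X in measurable X](_ : _ = setT)//; apply/seteqP; split.
Qed.

End borel_subgroups.

(** * Countable ordinals and iterated normalizers *)

(** Otherwise the countable initial segments below the [u n] would cover the uncountable
    [omega1]. *)
Lemma omega1_bound (u : nat -> omega1) : exists b, forall n, (u n <= b)%O.
Proof.
apply: contrapT => /forallNP nb; have := omega1_uncountable; apply/negP/negPn.
have -> : [set: omega1] = \bigcup_n [set b | (b <= u n)%O].
  apply/seteqP; split=> // b _; have /existsNP[n] := nb b.
  by move=> /negP; rewrite -ltNge => /ltW; exists n.
by apply: bigcup_countable => // n _; apply: omega1_countable_le.
Qed.

Lemma omega1_succ (a : omega1) : exists b, is_succ a b.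
Proof.
have [c ac] : exists c : omega1, (a < c)%O.
  apply: contrapT => /forallNP na; have := omega1_uncountable; apply/negP/negPn.
  have -> : [set: omega1] = [set b | (b <= a)%O]; last exact: omega1_countable_le.
  by apply/seteqP; split=> // b _ /=; rewrite leNgt; apply/negP.
have [|b ab bmin] := @omega1_min [set c | (a < c)%O]; first by exists c.
exists b; split=> // {ac}c cb.
by rewrite leNgt; apply/negP => /bmin; rewrite leNgt cb.
Qed.

(** A sequence whose values approach the supremum has an upper bound in [omega1], where monotonicity
    forces the supremum to be attained. *)
Lemma omega1_stable (R : realType) (f : omega1 -> R) (M : R) :
  {homo f : x y / (x <= y)%O >-> x <= y} -> (forall x, f x <= M) ->
  exists a, forall b, (a <= b)%O -> f b = f a.
Proof.
move=> fmono fM.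
have [c _] : exists c : omega1, True.
  apply: contrapT => /forallNP no; have := omega1_uncountable; apply/negP/negPn.
  have -> : [set: omega1] = set0 by apply/seteqP; split=> // x; case: (no x).
  exact: countable0.
have hs : has_sup (range f).
  by split; [exists (f c), c|exists M => _ [x _ <-]].
have /choice[u uP] : forall n, exists x, sup (range f) - n.+1%:R^-1 < f x.
  move=> n; have n0 : 0 < n.+1%:R^-1 :> R by rewrite invr_gt0.
  by have [_ [x _ <-] lt_x] := sup_adherent n0 hs; exists x.
have [a ua] := omega1_bound u.
have fsup x : f x <= sup (range f) by apply: ub_le_sup; [case: hs|exists x].
have supa : sup (range f) <= f a.
  apply/ler_addgt0Pr => eps eps0.
  have [n _ /(_ n (leqnn n)) neps] := near_infty_natSinv_lt (PosNum eps0).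
  have {}neps : n.+1%:R^-1 < eps by exact: neps.
  rewrite -lerBlDr; apply: le_trans (fmono _ _ (ua n)).
  by apply: ltW; apply: le_lt_trans (uP n); rewrite lerB// ltW.
exists a => b ab; apply/le_anti; rewrite (fmono _ _ ab) andbT.
exact: le_trans supa.
Qed.

Section iterated_normalizers.
Variable G : groupType.
Implicit Types (g : G) (H : {pred G}).

Lemma conj_predM g h H : conj_pred (g * h)%g H = conj_pred g (conj_pred h H).
Proof. by apply: eq_pred => x; rewrite !inE conjgM. Qed.

Lemma conj_pred_inj g : injective (@conj_pred G g).
Proof.
move=> H K HK; apply: eq_pred => x.
have : (x ^ g^-1)%g \in conj_pred g H = ((x ^ g^-1)%g \in conj_pred g K).
  by rewrite HK.
by rewrite !inE conjgKV.
Qed.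

Lemma normalizer_conj g H : normalizer (conj_pred g H) = conj_pred g (normalizer H).
Proof.
have E x : conj_pred x (conj_pred g H) = conj_pred g (conj_pred (x ^ g)%g H).
  by rewrite -!conj_predM conjgE !mulgA mulgV mul1g.
apply: eq_pred => x; rewrite [RHS]inE; apply/normalizerP/normalizerP; rewrite E.
  by move=> /eq_pred /conj_pred_inj ->.
by move=> /eq_pred ->.
Qed.

Lemma iter_normalizer_conj al g H :
  iter_normalizer al (conj_pred g H) = conj_pred g (iter_normalizer al H).
Proof.
elim/(well_founded_ind omega1_wf) : al => al IH.
have [[b sb]|nsucc] := pselect (exists b, is_succ b al).
  by rewrite !(iter_normalizerS _ sb) IH ?normalizer_conj//; case: sb.
have [exb|nexb] := pselect (exists b : omega1, (b < al)%O); last first.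
  rewrite !iter_normalizer0// => b; rewrite leNgt; apply/negP => bal; apply: nexb;
    by exists b.
apply: eq_pred => x; rewrite [RHS]inE; apply/idP/idP.
  move=> /(iter_normalizer_lim _ exb nsucc)[b ba]; rewrite IH// inE => xb.
  by apply/(iter_normalizer_lim _ exb nsucc); exists b.
move=> /(iter_normalizer_lim _ exb nsucc)[b ba] xb.
by apply/(iter_normalizer_lim _ exb nsucc); exists b => //; rewrite IH.
Qed.

Lemma iter_normalizer_subgp_conj al g (H : subgp G) :
  iter_normalizer_subgp al (conj_subgp g H) =
  conj_subgp g (iter_normalizer_subgp al H).
Proof.
apply: subgp_eq => x; rewrite mem_conj_subgp.
have := congr1 (fun K : {pred G} => x \in K) (iter_normalizer_conj al g H).
by rewrite [RHS]inE.
Qed.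

End iterated_normalizers.

(** * Random subgroups and NA-ergodic actions *)

Section random_subgroups.
Variables (R : realType) (G : groupType) (e : nat -> G).
Hypothesis e_surj : forall g, exists n, e n = g.
Variables (d : measure_display) (X : measurableType d) (mu : probability X R).
Implicit Types (phi psi : X -> subgp G) (s : seq G).
Local Open Scope ereal_scope.

(** For countable G this amounts to Borel measurability of [phi], by [measurable_fun_subgp] and
    [measurable_mem_subgp]. *)
Definition mem_measurable phi := forall g, measurable [set x | g \in phi x].

(* Amenability almost everywhere, tested on the countably many finitely generated
   subgroups; unlike the set of amenable subgroups, the sets occurring here are
   visibly Borel. *)
Definition nonamenable_null phi := forall s, ~ amenable R (gen s) ->
  mu [set x | {subset s <= phi x}] = 0.

Lemma measurable_iff (A B : set X) : measurable A -> measurable B ->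
  measurable [set x | A x <-> B x].
Proof.
move=> mA mB; rewrite [X in measurable X](_ : _ = (A `&` B) `|` (~` A `&` ~` B)).
  by apply: measurableU; apply: measurableI => //; apply: measurableC.
apply/seteqP; split=> x /=; rewrite /setI /setU /setC /=; last by tauto.
by have [|] := pselect (A x); tauto.
Qed.

Lemma measurable_impl (P : Prop) (A : set X) : measurable A ->
  measurable [set x | P -> A x].
Proof.
move=> mA; have [p|np] := pselect P.
  by rewrite [X in measurable X](_ : _ = A)//; apply/seteqP; split=> x /=; [apply|].
by rewrite [X in measurable X](_ : _ = setT)//; apply/seteqP; split=> // x _ /np.
Qed.

Lemma measurable_eq_subgp phi psi : mem_measurable phi -> mem_measurable psi ->
  measurable [set x | phi x = psi x].
Proof.
move=> mphi mpsi.
rewrite [X in measurable X](_ : _ =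
    \bigcap_n [set x | e n \in phi x <-> e n \in psi x]).
  apply: bigcapT_measurable => n.
  by apply: measurable_iff; [apply: mphi|apply: mpsi].
apply/seteqP; split=> x /=; first by move=> E n _ /=; rewrite E.
move=> E; apply: subgp_eq => g; have [n <-] := e_surj g.
by apply/idP/idP => h; apply/(E n I).
Qed.

Lemma mem_measurable_cst (H : subgp G) : mem_measurable (fun=> H).
Proof.
move=> g; have [gH|gH] := boolP (g \in H).
  by rewrite [X in measurable X](_ : _ = setT)//; apply/seteqP; split=> x.
by rewrite [X in measurable X](_ : _ = set0)//; apply/seteqP; split=> // x /=;
  rewrite (negbTE gH).
Qed.

Lemma measurable_subset phi s : mem_measurable phi ->
  measurable [set x | {subset s <= phi x}].
Proof.
move=> mphi; rewrite [X in measurable X](_ : _ =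
    \bigcap_n [set x | e n \in s -> e n \in phi x]).
  by apply: bigcapT_measurable => n; apply: measurable_impl; apply: mphi.
apply/seteqP; split=> x /= sx; first by move=> n _; apply: sx.
by move=> g; have [n <-] := e_surj g; apply: sx.
Qed.

Lemma seq_lift s : exists w : seq nat, map e w = s.
Proof.
elim: s => [|g s [w <-]]; first by exists [::].
by have [n <-] := e_surj g; exists (n :: w).
Qed.

Lemma null_countable_cover (F : seq nat -> set X) :
  (forall w, measurable (F w)) -> (forall w, mu (F w) = 0) ->
  mu.-negligible (\bigcup_w F w).
Proof.
move=> mF F0; pose F' n := if unpickle n is Some w then F w else set0.
have mF' n : measurable (F' n) by rewrite /F'; case: unpickle.
exists (\bigcup_n F' n); split.
- exact: bigcupT_measurable.
- by apply: measure_bigcup0 => // n; rewrite /F'; case: unpickle.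
- by move=> x [w _ Fx]; exists (pickle w) => //; rewrite /F' pickleK.
Qed.

(** By [amenable_gen], a non-amenable [phi x] contains a finite s with [gen s] non-amenable; coding
    s by a [seq nat] leaves countably many null sets. *)
Lemma nonamenable_null_ae phi : mem_measurable phi -> nonamenable_null phi ->
  {ae mu, forall x, amenable R (phi x)}.
Proof.
move=> mphi null.
pose F w := if `[< amenable R (gen (map e w)) >] then set0
            else [set x | {subset map e w <= phi x}].
apply: negligibleS (@null_countable_cover F _ _).
- move=> x /= nam; apply: contrapT => nF; apply: nam.
  apply: (amenable_gen e_surj (subgpP _)) => s sx.
  have [w ws] := seq_lift s; apply: contrapT => nam; apply: nF; exists w => //.
  by rewrite /F; case: asboolP; rewrite ws.
- by move=> w; rewrite /F; case: ifP => // _; apply: measurable_subset.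
- by move=> w; rewrite /F; case: asboolP => // nam; apply: null.
Qed.

End random_subgroups.

Section na_ergodic_actions.
Variables (R : realType) (G : groupType) (e : nat -> G).
Hypothesis e_surj : forall g, exists n, e n = g.
Variables (d : measure_display) (X : measurableType d) (mu : probability X R).
Variable a : mp_action G mu.
Implicit Types (phi : X -> subgp G) (g : G).
Local Open Scope ereal_scope.

Definition equivariant phi := forall g x, phi (a g x) = conj_subgp g (phi x).

Lemma actK g : cancel (a g) (a g^-1%g).
Proof. by move=> x; rewrite -actM mulVg act1. Qed.

Lemma actVK g : cancel (a g^-1%g) (a g).
Proof. by move=> x; rewrite -actM mulgV act1. Qed.

Lemma stab_equivariant : equivariant (stab a).
Proof.
move=> g x; apply: subgp_eq => h; rewrite mem_conj_subgp !inE conjgE !actM.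
apply/eqP/eqP => [->|hx]; first exact: actK.
by rewrite -[in RHS]hx actVK.
Qed.

(** Invariance is assumed as an implication for points of B; used for inverses as well, it gives the
    equalities of sets that [ergodic_on] asks for, both for B and for its traces. *)
Lemma na_ergodic_constant (K : {pred G}) (B : set X) (U : nat -> set X) :
  NA_ergodic a -> group_closed K -> ~ amenable R K ->
  measurable B -> (forall k, measurable (U k)) ->
  (forall g x, g \in K -> B x -> B (a g x) /\ forall k, U k (a g x) <-> U k x) ->
  mu B <> 0 ->
  exists2 x0, B x0 & let C := [set x | B x /\ forall k, U k x <-> U k x0] in
    measurable C /\ mu C = 1.
Proof.
move=> erg cK nam mB mU inv B0.
have VK g : g \in K -> (g^-1)%g \in K by apply: group_closedV.
have {}erg := erg K cK nam.
have B1 : mu B = 1.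
  have [//|//|//] := erg B mB _; move=> g gK; apply/seteqP; split=> x /= Bx.
    by rewrite -(actK g x); case: (inv _ _ (VK g gK) Bx).
  by case: (inv _ _ gK Bx).
have [|k|x0 Bx0] := @zero_one_point R d X mu B U mB mU; last first.
- by rewrite B1 => C1; exists x0.
- rewrite B1; apply: erg; first exact: measurableI.
  move=> g gK; apply/seteqP; split=> x /= [Bx Ux].
    have [+ /(_ k)] := inv _ _ (VK g gK) Bx.
    by rewrite actK => Bx' Uk; split=> //; apply/Uk.
  by have [Bgx /(_ k) Uk] := inv _ _ gK Bx; split=> //; apply/Uk.
- by rewrite B1.
Qed.

Lemma stab_measurable : standard_borel R X -> mem_measurable (stab a).
Proof.
move=> /standard_borel_separating[U [mU Usep]] g.
rewrite [X in measurable X](_ : _ =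
    \bigcap_n [set x | (a g @^-1` U n) x <-> U n x]).
  apply: bigcapT_measurable => n; apply: measurable_iff => //.
  by rewrite -[X in measurable X]setTI; apply: measurable_act.
apply/seteqP; split=> x /=; first by rewrite inE => /eqP E n _ /=; rewrite E.
by move=> E; rewrite inE; apply/eqP/Usep => k; apply: E.
Qed.

(** [gen s] fixes every point of B, so any sets have invariant traces on B. Separating ones shrink C
    to a single point that carries all the mass. *)
Lemma stab_nonamenable_null : standard_borel R X -> ~ point_mass mu ->
  NA_ergodic a -> nonamenable_null mu (stab a).
Proof.
move=> sX npt erg s nam; apply: contrapT => B0.
have [U [mU Usep]] := standard_borel_separating sX.
have mstab := stab_measurable sX.
have fixB g x : g \in gen s -> {subset s <= stab a x} -> a g x = x.
  by move=> gs sx; have := gen_sub (subgpP _) sx gs; rewrite inE => /eqP.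
have [||x0 _] := na_ergodic_constant erg (gen_closed s) nam _ mU _ B0.
- exact: measurable_subset.
- by move=> g x gs Bx; rewrite (fixB g x).
set C := [set x | _] => -[mC C1]; apply: npt; exists x0 => A mA.
have CE x : C x -> x = x0 by move=> [_ /Usep].
rewrite diracE; case: (boolP (x0 \in A)) => [/set_mem Ax0|].
  apply/eqP; rewrite eq_le probability_le1//= -C1.
  apply: le_measure; rewrite ?inE//.
  by move=> x /CE ->.
move=> /negP nA; apply: subset_measure0 (_ : mu (~` C) = 0) => //.
- exact: measurableC.
- by move=> x Ax /CE xx0; apply: nA; rewrite -xx0 inE.
- by rewrite probability_setC// C1 subee.
Qed.

(* The pushforward of mu under phi is a point mass. *)
Definition ae_constant phi := exists H, mu [set x | phi x = H] = 1.

(** Where s lies in [psi x], [gen s] normalizes [phi x], so by equivariance [phi] does not change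
    along its orbits and the coordinates of [phi] have invariant traces. *)
Lemma normalizer_nonamenable_null phi psi : NA_ergodic a ->
  mem_measurable phi -> mem_measurable psi -> equivariant phi ->
  (forall x, psi x =i normalizer (phi x)) ->
  ~ ae_constant phi -> nonamenable_null mu psi.
Proof.
move=> erg mphi mpsi eqv psiE ncst s nam; apply: contrapT => B0.
have fixB g x : g \in gen s -> {subset s <= psi x} -> phi (a g x) = phi x.
  move=> gs sx; rewrite eqv; apply/normalizer_conjE; rewrite -psiE.
  exact: gen_sub (subgpP _) sx _ gs.
have [|||x0 _] := na_ergodic_constant (U := fun k => [set x | e k \in phi x])
    erg (gen_closed s) nam _ _ _ B0.
- exact: measurable_subset.
- by move=> k; apply: mphi.
- move=> g x gs Bx; split=> [h hs|k]; last by rewrite /= (fixB g x).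
  by rewrite psiE (fixB g x)// -psiE; apply: Bx.
set C := [set x | _] => -[mC C1]; apply: ncst; exists (phi x0).
have mE : measurable [set x | phi x = phi x0].
  by apply: measurable_eq_subgp => //; apply: mem_measurable_cst.
apply/eqP; rewrite eq_le probability_le1//= -C1; apply: le_measure; rewrite ?inE//.
move=> x [_ E] /=; apply: subgp_eq => g; have [n <-] := e_surj g.
by apply/idP/idP => h; apply/(E n).
Qed.

End na_ergodic_actions.

(** * Invariant random subgroups *)

Section invariant_random_subgroups.
Variables (R : realType) (G : groupType) (e : nat -> G).
Hypothesis e_surj : forall g, exists n, e n = g.
Variable nu : probability (borel_subgp G) R.
Local Open Scope ereal_scope.

Lemma measurable_subgp1 (H : subgp G) : measurable ([set H] : set (borel_subgp G)).
Proof.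
apply: (measurable_eq_subgp e_surj (phi := fun K : borel_subgp G => (K : subgp G))
  (psi := fun=> H)); first exact: measurable_mem_subgp.
exact: mem_measurable_cst.
Qed.

Lemma ae_atom (P : subgp G -> Prop) (H : subgp G) :
  {ae nu, forall K : subgp G, P K} -> nu [set H] <> 0 -> P H.
Proof.
move=> [N [mN N0 PN]] H0; apply: contrapT => nPH; apply: H0.
apply: subset_measure0 N0 => //; first exact: measurable_subgp1.
by move=> _ ->; apply: PN.
Qed.

(** By invariance all conjugates of an atom have the same positive mass c, while the total mass is
    1. *)
Lemma IRS_atom_finite_conj (H : subgp G) : is_IRS nu -> nu [set H] <> 0 ->
  finite_set [set conj_subgp g H | g in [set: G]].
Proof.
move=> irs H0; apply: contrapT => infO.
have conjH g : nu [set conj_subgp g H] = nu [set H].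
  rewrite -[LHS](irs g); last exact: measurable_subgp1.
  congr (nu _).
  apply/seteqP; split=> K KH; last by rewrite /= KH.
  exact: (can_inj (conj_subgpK g)) KH.
pose c := fine (nu [set H]).
have cE : nu [set H] = c%:E.
  by rewrite fineK// fin_num_measure//; apply: measurable_subgp1.
have c0 : (0 < c)%R.
  have : 0 <= nu [set H] by exact: measure_ge0.
  rewrite cE lee_fin le_eqVlt => /orP[/eqP c0|//].
  by case: H0; rewrite cE -c0.
have sum_seq (s : seq (subgp G)) : uniq s ->
    (forall K, K \in s -> exists g, conj_subgp g H = K) ->
    measurable ([set` s] : set (borel_subgp G)) /\
    nu [set` s] = ((size s)%:R * c)%:E.
  elim: s => [|K s IH] /=; first by rewrite set_nil measure0 mul0r.
  move=> /andP[Ks us] sO.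
  have [|ms nus] := IH us; first by move=> L Ls; apply: sO; rewrite inE Ls orbT.
  have [g gK] := sO K (mem_head _ _).
  have mK := measurable_subgp1 K.
  have -> : [set` K :: s] = [set K] `|` [set` s].
    apply/seteqP; split=> L /=; rewrite inE.
      by move=> /predU1P[->|Ls]; [left|right].
    by move=> [->|Ls]; apply/predU1P; [left|right].
  split; first exact: measurableU.
  transitivity (nu [set K] + nu [set` s]).
    apply: measureU => //.
    by apply/seteqP; split=> // L [/= ->]; rewrite (negbTE Ks).
  rewrite nus -gK conjH cE.
  by rewrite -EFinD mulrSr mulrDl mul1r addrC.
(* Any n > 1/c distinct conjugates would have mass above 1. *)
have [n cn] : exists n : nat, (1 < n%:R * c)%R.
  exists (Num.bound c^-1); rewrite -ltr_pdivrMr// div1r.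
  by apply: archi_boundP; rewrite invr_ge0 ltW.
have [B BO nB] := infinite_set_fset n infO.
have [|K KB|mB nuB] := sum_seq (finmap.enum_fset B).
- exact: finmap.fset_uniq.
- by have [g _ gK] := BO K KB; exists g.
have := probability_le1 nu mB; rewrite nuB lee_fin leNgt; apply/negP; rewrite negbK.
by apply: lt_le_trans cn _; rewrite ler_pM2r// ler_nat.
Qed.

Lemma IRS_no_atom : ~ amenable R (predT : {pred G}) -> is_IRS nu ->
  {ae nu, forall H : subgp G, self_normalizing H} ->
  {ae nu, forall H : subgp G, amenable R H} ->
  forall H : subgp G, nu [set H] = 0.
Proof.
move=> namG irs sn am H; apply: contrapT => H0; apply: namG.
apply: (amenable_finite_conj (IRS_atom_finite_conj irs H0)).
- exact: (ae_atom sn H0).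
- exact: (ae_atom am H0).
Qed.

(** [nonatomic] speaks of atoms that are arbitrary Borel sets; [zero_one_point], applied to the
    coordinate sets, shrinks such an atom to a single subgroup of the same mass. *)
Lemma nonatomic_subgp : (forall H : subgp G, nu [set H] = 0) -> nonatomic nu.
Proof.
move=> nu1 [A [mA A0 Aatom]].
have mmem k := measurable_mem_subgp (e k).
have [|H AH] := @zero_one_point _ _ _ nu A _ mA mmem A0.
  move=> k; apply: Aatom; [exact: measurableI|exact: subIsetl].
move=> /= [mC CA]; move: A0; rewrite -CA; apply/negP; rewrite -leNgt.
rewrite -(nu1 H); apply: le_measure; rewrite ?inE//; first exact: measurable_subgp1.
move=> K [_ KH] /=; apply: subgp_eq => g; have [n <-] := e_surj g.
by apply/idP/idP => h; apply/(KH n).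
Qed.

Lemma ae_infinitely_generated : (forall H : subgp G, nu [set H] = 0) ->
  {ae nu, forall H : subgp G, ~ finitely_generated H}.
Proof.
move=> nu1.
pose F w : set (borel_subgp G) := [set mk_subgp (gen_closed (map e w))].
apply: negligibleS (@null_countable_cover _ _ _ nu F _ _).
- move=> H /= /contrapT[s sH Hs]; have [w ws] := seq_lift e_surj s.
  exists w => //=; apply: subgp_eq => g; rewrite ws; apply/idP/idP.
    exact: Hs (gen_closed s) (@sub_gen _ s) _.
  exact: gen_sub (subgpP H) sH g.
- by move=> w; apply: measurable_subgp1.
- by move=> w; apply: nu1.
Qed.

End invariant_random_subgroups.

(** * Iterated normalizers of stabilizers *)

Section stabilizer_normalizers.
Variables (R : realType) (G : groupType) (e : nat -> G).
Hypothesis e_surj : forall g, exists n, e n = g.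
Variables (d : measure_display) (X : measurableType d) (mu : probability X R).
Variable a : mp_action G mu.
Hypotheses (sX : standard_borel R X) (npt : ~ point_mass mu).
Hypothesis erg : NA_ergodic a.
Local Open Scope ereal_scope.

Definition normal_stab (al : omega1) (x : X) : subgp G :=
  iter_normalizer_subgp al (stab a x).

Lemma normal_stab_equivariant al : equivariant a (normal_stab al).
Proof.
by move=> g x; rewrite /normal_stab stab_equivariant iter_normalizer_subgp_conj.
Qed.

Lemma normal_stab_mono al be x : (al <= be)%O ->
  {subset normal_stab al x <= normal_stab be x}.
Proof. exact: (iter_normalizer_closed_mono be (subgpP (stab a x))).2. Qed.

Lemma normal_stab_succ b al x : is_succ b al ->
  normal_stab al x =i normalizer (normal_stab b x).
Proof.
move=> sb g.
by rewrite -[LHS]/(g \in iter_normalizer _ _) (iter_normalizerS _ sb).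
Qed.

Lemma normal_stab_lim al x g :
  (exists b : omega1, (b < al)%O) -> ~ (exists b, is_succ b al) ->
  g \in normal_stab al x <-> exists2 b : omega1, (b < al)%O & g \in normal_stab b x.
Proof. by move=> exb nsucc; apply: (iter_normalizer_lim _ exb nsucc). Qed.

Lemma normal_stab0 al x : (forall b : omega1, (al <= b)%O) ->
  normal_stab al x = stab a x.
Proof.
move=> al0; apply: subgp_eq => g.
by rewrite -[LHS]/(g \in iter_normalizer _ _) iter_normalizer0.
Qed.

Lemma stab_sub_normal_stab al x : {subset stab a x <= normal_stab al x}.
Proof.
have [|b _ bmin] := @omega1_min setT; first by exists al.
rewrite -(@normal_stab0 b x) => [|c]; last exact: bmin.
by apply: normal_stab_mono; apply: bmin.
Qed.

Lemma omega1_cases (al : omega1) :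
  [\/ forall b : omega1, (al <= b)%O, exists b, is_succ b al |
      (exists b : omega1, (b < al)%O) /\ ~ exists b, is_succ b al].
Proof.
have [|nsucc] := pselect (exists b, is_succ b al); first by apply: Or32.
have [exb|nexb] := pselect (exists b : omega1, (b < al)%O); first by apply: Or33.
by apply: Or31 => b; rewrite leNgt; apply/negP => ba; apply: nexb; exists b.
Qed.

Lemma measurable_normalizer (phi psi : X -> subgp G) :
  (forall x, psi x =i normalizer (phi x)) ->
  mem_measurable phi -> mem_measurable psi.
Proof.
move=> psiE mphi g; rewrite [X in measurable X](_ : _ =
    \bigcap_n [set x | (e n ^ g)%g \in phi x <-> e n \in phi x]).
  by apply: bigcapT_measurable => n; apply: measurable_iff; apply: mphi.
apply/seteqP; split=> x /=; rewrite psiE.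
  by move=> /normalizerP gN n _ /=; rewrite -[X in _ <-> is_true X]gN.
move=> gN; apply/normalizerP => h; rewrite inE; have [n <-] := e_surj h.
by apply/idP/idP => hx; apply/(gN n I).
Qed.

Lemma omega1_below (al : omega1) : (exists b : omega1, (b < al)%O) ->
  exists2 u : nat -> omega1, (forall n, (u n < al)%O) &
    forall b, (b < al)%O -> exists n, u n = b.
Proof.
move=> ex; apply: (@countable_enumeration _ [set b | (b < al)%O]) => //.
apply: sub_countable (omega1_countable_le al).
by apply: subset_card_le => b /ltW.
Qed.

Lemma normal_stab_measurable al : mem_measurable (normal_stab al).
Proof.
elim/(well_founded_ind omega1_wf) : al => al IH.
have [al0|[b sb]|[exb nsucc]] := omega1_cases al.
- have -> : normal_stab al = stab a by apply/funext => x; apply: normal_stab0.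
  exact: stab_measurable.
- apply: measurable_normalizer (IH b _); last by case: sb.
  by move=> x; apply: normal_stab_succ.
have [u ual uP] := omega1_below exb => g.
rewrite [X in measurable X](_ : _ = \bigcup_n [set x | g \in normal_stab (u n) x]).
  by apply: bigcupT_measurable => n; apply: IH.
apply/seteqP; split=> x /=.
  move=> /(normal_stab_lim _ _ exb nsucc)[b ba gb].
  by have [n nb] := uP _ ba; exists n; rewrite //= nb.
by move=> [n _ /= gn]; apply/(normal_stab_lim _ _ exb nsucc); exists (u n).
Qed.

Lemma normal_stab_nonamenable_null al :
  (forall b : omega1, (b < al)%O -> ~ ae_constant mu (normal_stab b)) ->
  nonamenable_null mu (normal_stab al).
Proof.
elim/(well_founded_ind omega1_wf) : al => al IH ncst.
have [al0|[b sb]|[exb nsucc]] := omega1_cases al.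
- have -> : normal_stab al = stab a by apply/funext => x; apply: normal_stab0.
  exact: stab_nonamenable_null.
- apply: (normalizer_nonamenable_null e_surj erg (normal_stab_measurable b)).
  + exact: normal_stab_measurable.
  + exact: normal_stab_equivariant.
  + by move=> x; apply: normal_stab_succ.
  + by apply: ncst; case: sb.
have [u ual uP] := omega1_below exb => s nam.
have mF n : measurable [set x | {subset s <= normal_stab (u n) x}].
  by apply: measurable_subset => //; apply: normal_stab_measurable.
have mL : measurable [set x | {subset s <= normal_stab al x}].
  by apply: measurable_subset => //; apply: normal_stab_measurable.
have F0 n : mu [set x | {subset s <= normal_stab (u n) x}] = 0.
  by apply: (IH _ (ual n)) => // b bu; apply: ncst; apply: lt_trans (ual n).
apply: subset_measure0 (measure_bigcup0 mF F0) => //.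
  exact: bigcupT_measurable.
move=> x /= sx.
(* The stages increase, so finitely many elements that appear below the limit are all present at one
   earlier stage. *)
suff [b ba sb] : exists2 b : omega1, (b < al)%O & {subset s <= normal_stab b x}.
  by have [n nb] := uP _ ba; exists n; rewrite //= nb.
elim: (s) sx => [_|g t IHt sx]; first by have [b ba] := exb; exists b.
have [|b ba tb] := IHt; first by move=> h ht; apply: sx; rewrite inE ht orbT.
have /(normal_stab_lim _ _ exb nsucc)[c ca gc] := sx g (mem_head _ _).
have [bc|cb] := leP b c.
  exists c => // h; rewrite inE => /predU1P[->//|/tb].
  exact: normal_stab_mono.
exists b => // h; rewrite inE => /predU1P[->|/tb//].
exact: normal_stab_mono (ltW cb) _ gc.
Qed.

(* For each g, the measure of {x | g \in N^al(G_x)} is a nondecreasing bounded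
   function of al. *)
Lemma normal_stab_stable :
  exists al, forall b : omega1, (al <= b)%O ->
    mu [set x | normal_stab b x <> normal_stab al x] = 0.
Proof.
pose E b n := [set x | e n \in normal_stab b x].
have mE b n : measurable (E b n) by apply: normal_stab_measurable.
have Emono (b c : omega1) n : (b <= c)%O -> E b n `<=` E c n.
  by move=> bc x; apply: normal_stab_mono.
have /choice[u uP] : forall n, exists al, forall b : omega1, (al <= b)%O ->
    fine (mu (E b n)) = fine (mu (E al n)).
  move=> n; apply: (@omega1_stable _ _ 1%R) => [b c bc|b].
    apply: fine_le; rewrite ?fin_num_measure//.
    by apply: le_measure; rewrite ?inE//; apply: Emono.
  by rewrite -lee_fin fineK ?probability_le1// fin_num_measure.
have [al ual] := omega1_bound u; exists al => b ab.
(* As the stages increase, b and al differ at x exactly when some e n has joined after al. *)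
rewrite [X in mu X](_ : _ = \bigcup_n (E b n `\` E al n)); last first.
  apply/seteqP; split=> x /=.
    move=> nx; apply: contrapT => nE; apply: nx; apply: subgp_eq => g.
    apply/idP/idP; last exact: normal_stab_mono.
    have [n <-] := e_surj g => gb; apply: contrapT => ga; apply: nE.
    by exists n.
  by move=> [n _ [gb ga]] E'; apply: ga; rewrite /E /= -E'.
apply: measure_bigcup0 => n; first exact: measurableD.
rewrite probability_setD// setIidr; last exact: Emono.
suff -> : mu (E b n) = mu (E al n) by rewrite subee// fin_num_measure.
rewrite -[LHS]fineK ?fin_num_measure// -[RHS]fineK ?fin_num_measure//.
by rewrite (uP n b (le_trans (ual n) ab)) (uP n al (ual n)).
Qed.

End stabilizer_normalizers.

(** * The two alternatives of the theorem *)

Lemma normal_stab_ae_constant (R : realType) (G : groupType) (e : nat -> G)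
    (d : measure_display) (X : measurableType d) (mu : probability X R)
    (a : mp_action G mu) :
  (forall g, exists n, e n = g) -> standard_borel R X -> ~ point_mass mu ->
  NA_ergodic a ->
  (exists al, ae_constant mu (normal_stab a al)) ->
  exists N : {pred G}, [/\ normal_subgroup N, amenable R N &
    {ae mu, forall x, {subset stab a x <= N}}].
Proof.
move=> e_surj sX npt erg exal.
(* Leastness makes all earlier stages non-constant, as [normal_stab_nonamenable_null] requires. *)
have [|al [H H1] almin] :=
  @omega1_min [set al | ae_constant mu (normal_stab a al)].
  by have [al ?] := exal; exists al.
have mphi : mem_measurable (normal_stab a al) by exact: normal_stab_measurable.
have mE K : measurable [set x | normal_stab a al x = K].
  by apply: measurable_eq_subgp => //; apply: mem_measurable_cst.
have aeE : {ae mu, forall x, normal_stab a al x = H}.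
  exists (~` [set x | normal_stab a al x = H]); split=> //.
    exact: measurableC.
  by rewrite probability_setC// H1 subee.
have ex_ae (P : X -> Prop) : {ae mu, forall x, P x} -> exists x, P x.
  move=> [M [mM M0 PM]]; apply: contrapT => nP.
  have : mu M = 1%E.
    rewrite (_ : M = setT) ?probability_setT//; apply/seteqP; split=> // x _.
    by apply: PM => /= Px; apply: nP; exists x.
  by rewrite M0 => /eqP; rewrite eq_sym onee_eq0.
exists (pred_of_subgp H); split.
- split=> [|g]; first exact: subgpP.
  suff gH : conj_subgp g H = H by move=> x; rewrite -[in RHS]gH.
  have mg : measurable (a g @^-1` [set x | normal_stab a al x = H]).
    by rewrite -[X in measurable X]setTI; apply: measurable_act.
  have aeg : {ae mu, forall x, normal_stab a al (a g x) = H}.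
    exists (~` (a g @^-1` [set x | normal_stab a al x = H])); split=> //.
      exact: measurableC.
    by rewrite probability_setC// measure_act// H1 subee.
  (* At a common point x of the two full sets, H is the value at gx, which equivariance identifies
     with gHg^-1. *)
  have [x [/= xH gxH]] := ex_ae _ (filterI aeE aeg).
  by rewrite -[RHS]gxH (@normal_stab_equivariant R G d X mu a) xH.
- have null : nonamenable_null mu (normal_stab a al).
    apply: (normal_stab_nonamenable_null e_surj) => // b ba cst.
    by have := almin b cst; rewrite leNgt ba.
  have am := nonamenable_null_ae e_surj mphi null.
  by have [y [/= <-]] := ex_ae _ (filterI aeE am).
- apply: filterS aeE => y <- g; exact: stab_sub_normal_stab.
Qed.

Theorem theorem3p13 (R : realType) (G : groupType)
    (d : measure_display) (X : measurableType d) (mu : probability X R)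
    (a : mp_action G mu) :
  countable [set: G] ->
  standard_borel R X ->
  ~ point_mass mu ->
  NA_ergodic a ->
  {ae mu, forall x, amenable R (stab a x)} /\
  ((exists N : {pred G}, [/\ normal_subgroup N, amenable R N &
      {ae mu, forall x, {subset stab a x <= N}}]) \/
   (exists theta_oo : probability (borel_subgp G) R,
      is_theta_infty (stab_distribution a) theta_oo /\
      [/\ is_IRS theta_oo,
          nonatomic theta_oo,
          {ae theta_oo, forall H : subgp G, self_normalizing H},
          {ae theta_oo, forall H : subgp G, ~ finitely_generated H} &
          {ae theta_oo, forall H : subgp G, amenable R H}])).
Proof.
move=> cG sX npt erg.
have [|e _ e_all] := countable_enumeration cG; first by exists 1%g.
have e_surj g : exists n, e n = g by exact: e_all.
split.
  apply: (nonamenable_null_ae e_surj); first exact: stab_measurable.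
  exact: stab_nonamenable_null.
(* Non-amenability of G is what later excludes atoms, through [IRS_no_atom]. *)
have [amG|namG] := pselect (amenable R (predT : {pred G})).
  left; exists (predT : {pred G}); split=> //; last exact: aeW.
have [cst|ncst] := pselect (exists al, ae_constant mu (normal_stab a al)).
  left; exact: normal_stab_ae_constant cst.
right.
have mphi be : mem_measurable (normal_stab a be) by exact: normal_stab_measurable.
have [al stable] := normal_stab_stable e_surj a sX.
pose phi := normal_stab a al : X -> borel_subgp G.
have mfphi be : measurable_fun [set: X] (normal_stab a be : X -> borel_subgp G).
  exact: (measurable_fun_subgp e_surj (mphi be)).
have mpre be (A : set (borel_subgp G)) : measurable A ->
    measurable (normal_stab a be @^-1` A).
  by move=> mA; rewrite -[X in measurable X]setTI; apply: mfphi.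
pose f : {mfun X >-> borel_subgp G} := HB.pack phi
  (isMeasurableFun.Build _ _ _ _ phi (mfphi al)).
(* The candidate for the eventual value is the law of the stage al after which almost nothing
   changes. *)
pose theta : probability (borel_subgp G) R := distribution mu f.
have irs : is_IRS theta.
  move=> g A mA; rewrite -[RHS](measure_act a g (mpre al A mA)).
  congr (mu _); apply/seteqP; split=> x /=;
    by rewrite (normal_stab_equivariant a al g x).
have sn : {ae theta, forall H : subgp G, self_normalizing H}.
  pose norm (H : subgp G) : subgp G := mk_subgp (normalizer_closed H).
  have mnorm : measurable ([set H | norm H = H] : set (borel_subgp G)).
    apply: (measurable_eq_subgp e_surj (X := borel_subgp G) (phi := norm)
      (psi := id)); last exact: measurable_mem_subgp.
    apply: (measurable_normalizer e_surj (X := borel_subgp G) (phi := id)) => //.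
    exact: measurable_mem_subgp.
  exists (~` [set H | norm H = H]); split; first exact: measurableC.
    (* Self-normalization fails exactly where the stage after al differs from stage al, which is a
       null set. *)
    have [b sb] := omega1_succ al; rewrite -[RHS](stable b (ltW sb.1)).
    congr (mu _); apply/seteqP; split=> x /= nx xE; apply: nx.
      rewrite /f /= /phi -[RHS]xE; apply: subgp_eq => g.
      by rewrite (normal_stab_succ a x sb).
    rewrite -[RHS]xE; apply: subgp_eq => g.
    by rewrite (normal_stab_succ a x sb).
  by move=> H /= nH nE; apply: nH => g; rewrite -[in RHS]nE.
have am : {ae theta, forall H : subgp G, amenable R H}.
  apply: (nonamenable_null_ae e_surj (mu := theta) (phi := id)).
    exact: measurable_mem_subgp.
  have null : nonamenable_null mu (normal_stab a al).
    apply: (normal_stab_nonamenable_null e_surj) => // b _ cst.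
    by apply: ncst; exists b.
  exact: null.
have theta1 := IRS_no_atom e_surj namG irs sn am.
exists theta; split; last first.
  split=> //; first exact: (nonatomic_subgp e_surj theta1).
  exact: (ae_infinitely_generated e_surj theta1).
exists al => b ab A mA.
(* Off this null set the stages b and al coincide, so their laws agree on Borel sets. *)
pose N := [set x | normal_stab a b x <> normal_stab a al x].
have mN : measurable N.
  by apply: measurableC; apply: measurable_eq_subgp.
transitivity (mu (normal_stab a b @^-1` A `\` N)).
  by rewrite measure_setD0//; [apply: mpre|apply: stable].
transitivity (mu (normal_stab a al @^-1` A `\` N)).
  congr (mu _); apply/seteqP; split=> x [Ax /contrapT xE]; split=> //.
  - by rewrite /preimage /= -xE.
  - by rewrite /preimage /= xE.
by rewrite measure_setD0//; [apply: mpre|apply: stable].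
Qed.
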